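(* Let $n\ge 1$, let $\lambda,\beta>0$, and let $\alpha_1,\dots,\alpha_n>0$ and $\alpha_1^*,\dots,\alpha_n^*>0$. Let $X_1,\dots,X_n$ be independent random variables with $X_i\sim \mathrm{ENH}(\alpha_i,\lambda,\beta)$, and let $X_1^*,\dots,X_n^*$ be independent random variables with $X_i^*\sim \mathrm{ENH}(\alpha_i^*,\lambda,\beta)$, $i=1,\dots,n$. Write $X_{n:n}=\max_i X_i$ and $X^*_{n:n}=\max_i X_i^*$. If $(\alpha_1,\dots,\alpha_n)\stackrel{\mathrm{w}}{\succeq}(\alpha_1^*,\dots,\alpha_n^* )$, then $X_{n:n}\ge_{\mathrm{st}}X^*_{n:n}$.
   Context: For $\alpha,\lambda,\beta>0$, $X\sim \mathrm{ENH}(\alpha,\lambda,\beta)$ (exponentiated Nadarajah-Haghighi distribution) means that $X$ is a positive random variable with distribution function $[1-\exp\{1-(1+\lambda x)^{\alpha}\}]^{\beta}$ for $x>0$ (and $0$ for $x\le 0$). Weak supermajorization: for vectors $\boldsymbol{x},\boldsymbol{y}\in\mathbb{R}^n$ with increasing arrangements $x_{(1)}\le\dots\le x_{(n)}$ and $y_{(1)}\le\dots\le y_{(n)}$, $\boldsymbol{y}\stackrel{\mathrm{w}}{\succeq}\boldsymbol{x}$ (equivalently $\boldsymbol{x}\stackrel{\mathrm{w}}{\preceq}\boldsymbol{y}$) means $\sum_{i=1}^{j}x_{(i)}\ge\sum_{i=1}^{j}y_{(i)}$ for all $j=1,\dots,n$. Usual stochastic order: $X\le_{\mathrm{st}}Y$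 (equivalently $Y\ge_{\mathrm{st}}X$) means $P(X>x)\le P(Y>x)$ for all $x$. *)

(* Defs.v *)
From HB Require Import structures.
From mathcomp Require Import all_boot all_order all_algebra.
From mathcomp Require Import all_classical all_reals all_analysis.
From mathcomp Require Import measurable_realfun.

Set Implicit Arguments.
Unset Strict Implicit.
Unset Printing Implicit Defensive.

Import Order.TTheory GRing.Theory Num.Def Num.Theory.

Local Open Scope classical_set_scope.
Local Open Scope ring_scope.

Definition ENH_cdf (R : realType) (alpha lambda beta x : R) : R :=
  if 0 < x then (1 - expR (1 - (1 + lambda * x) `^ alpha)) `^ beta else 0.

(* At x = 0 this gives P (X <= 0) = 0, so X is almost surely positive. *)
Definition ENH (R : realType) (alpha lambda beta : R) (d : measure_display)
    (T : measurableType d) (P : probability T R) (X : {RV P >-> R}) : Prop :=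
  forall x : R, cdf X x = (ENH_cdf alpha lambda beta x)%:E.

Definition mutually_independent (R : realType) (d : measure_display)
    (T : measurableType d) (P : probability T R) (I : finType)
    (X : I -> {RV P >-> R}) : Prop :=
  forall (J : {set I}) (B : I -> set R), (forall i, measurable (B i)) ->
    P (\bigcap_(i in [set` J]) (X i @^-1` B i)) =
    (\prod_(i in J) P (X i @^-1` B i))%E.

Section max_rv.
Context (R : realType) (d : measure_display) (T : measurableType d).
Variables (P : probability T R) (n : nat) (X : 'I_n.+1 -> {RV P >-> R}).

(* The default value X ord0 w is one of the X i w, so it does not affect the
   maximum. *)
Definition max_fun (w : T) : R := \big[maxr/X ord0 w]_(i < n.+1) X i w.

Let measurable_max_fun : measurable_fun [set: T] max_fun.
Proof.
rewrite /max_fun.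
elim: (index_enum _) => [|i s IHs].
  under eq_fun do rewrite big_nil.
  exact: measurable_funPT.
under eq_fun do rewrite big_cons.
by apply: measurable_maxr => //; exact: measurable_funPT.
Qed.

HB.instance Definition _ := isMeasurableFun.Build _ _ _ _ max_fun
  measurable_max_fun.

Definition max_rv : {RV P >-> R} := max_fun.

End max_rv.

(* [wsupmaj y x] : y weakly supermajorizes x.  The j-th entry (from 0) of the
   sorted sequence is the order statistic of rank j.+1. *)
Definition wsupmaj (R : realType) (n : nat) (y x : 'I_n -> R) : Prop :=
  let incr (z : 'I_n -> R) := sort <=%R [seq z i | i <- enum 'I_n] in
  forall j : nat, (1 <= j <= n)%N ->
    \sum_(i < j) (incr y)`_i <= \sum_(i < j) (incr x)`_i.

Definition st_le (R : realType) (d d' : measure_display)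
    (T : measurableType d) (T' : measurableType d')
    (P : probability T R) (P' : probability T' R)
    (X : {RV P >-> R}) (Y : {RV P' >-> R}) : Prop :=
  forall x : R, (ccdf X x <= ccdf Y x)%E.

(* Main.v *)
Require Import Defs.
From mathcomp Require Import all_boot all_order all_algebra.
From mathcomp Require Import all_classical all_reals all_analysis.
From mathcomp Require Import ring lra.

Set Implicit Arguments.
Unset Strict Implicit.
Unset Printing Implicit Defensive.

Import Order.TTheory GRing.Theory Num.Def Num.Theory.
Import numFieldNormedType.Exports.

Local Open Scope classical_set_scope.
Local Open Scope ring_scope.

(** The theorem says that a product of distribution functions is monotone for
    weak supermajorization.  By independence, P (max X_i <= x) is the product
    of the [ENH_cdf (alpha i) lambda beta x].  For x <= 0 all factors vanish.
    For x > 0 put c := ln (1 + lambda x) > 0.  The logarithm of the product is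
    beta times the sum of the g (alpha i), where

      g a := ln (1 - exp (1 - exp (c a)))

    is [lnENH c a].  So it suffices that g is nondecreasing and concave on the
    positive half-line, because sums of such a function increase when the
    vector is replaced by one that it weakly supermajorizes (the Tomic-Weyl
    inequality, [wsupmaj_sum_le]).

    With u := exp (c a) > 1, the derivative of g at a is
    c u / (exp (u - 1) - 1) ([is_derive_lnENH]).  It is nonnegative, and it is
    nonincreasing because u / (exp (u - 1) - 1) decreases for u > 1
    ([ler_div_expRB1]).

    For the Tomic-Weyl inequality, let y weakly supermajorize x, both sorted
    increasingly.  The tangent of g at x_i gives
    g (x_i) - g (y_i) >= g' (x_i) (x_i - y_i).  The weights g' (x_i) are
    nonnegative and nonincreasing in i, and the partial sums of the x_i - y_i
    are nonnegative by hypothesis, so the weighted sum of these differences is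
    nonnegative by Abel summation ([ge_abel_sum]). *)

(** * Sums over weakly supermajorized vectors *)

(** Abel summation in a form that goes through by induction: since the partial
    sums of d are nonnegative, replacing the common weight of the first terms
    by the next, smaller one can only decrease the weighted sum.  If moreover
    the last weight is nonnegative, so is the weighted sum. *)
Lemma ge_abel_sum (R : realDomainType) (m : nat) (s d : nat -> R) :
  (forall i j, (i <= j <= m)%N -> s j <= s i) ->
  (forall j, (j <= m)%N -> 0 <= \sum_(i < j) d i) ->
  s m * \sum_(i < m.+1) d i <= \sum_(i < m.+1) s i * d i.
Proof.
elim: m => [|m IHm] s_anti d_ge0; first by rewrite !big_ord1.
rewrite big_ord_recr [leRHS]big_ord_recr /= mulrDr lerD2r.
apply: le_trans (IHm _ _).
- by apply: ler_wpM2r; [exact: d_ge0|apply: s_anti; rewrite leqnSn leqnn].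
- by move=> i j /andP[ij jm]; apply: s_anti; rewrite ij ltnW.
- by move=> j jm; apply: d_ge0; rewrite ltnW.
Qed.

(** The Tomic-Weyl inequality.  Concavity and monotonicity of f on D enter
    only through a nonnegative and nonincreasing choice s of supergradients;
    this keeps the lemma free of differentiability. *)
Lemma wsupmaj_sum_le (R : realType) (n : nat) (D : set R) (f s : R -> R)
    (y x : 'I_n -> R) :
  (forall i, D (y i)) -> (forall i, D (x i)) ->
  (forall a, D a -> 0 <= s a) ->
  (forall a b, D a -> D b -> a <= b -> s b <= s a) ->
  (forall a b, D a -> D b -> f b - f a <= s a * (b - a)) ->
  wsupmaj y x -> \sum_(i < n) f (y i) <= \sum_(i < n) f (x i).
Proof.
case: n y x => [|m] y x Dy Dx s_ge0 s_anti f_tangent maj.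
  by rewrite !big_ord0.
pose incr (z : 'I_m.+1 -> R) := sort <=%R [seq z i | i <- enum 'I_m.+1].
have size_incr z : size (incr z) = m.+1.
  by rewrite size_sort size_map size_enum_ord.
have sum_incr z : \sum_(i < m.+1) f (z i) = \sum_(i < m.+1) f (incr z)`_i.
  transitivity (\sum_(a <- incr z) f a); last first.
    by rewrite [LHS](big_nth 0) size_incr big_mkord.
  by rewrite (perm_big _ (permEl (perm_sort _ _))) big_map big_enum.
have D_incr z i : (forall j, D (z j)) -> (i <= m)%N -> D (incr z)`_i.
  move=> Dz im; have : (incr z)`_i \in incr z by rewrite mem_nth ?size_incr.
  by rewrite mem_sort => /mapP[j _ ->].
have incr_le z i j : (i <= j <= m)%N -> (incr z)`_i <= (incr z)`_j.
  move=> /andP[ij jm]; apply: (sorted_leq_nth le_trans le_refl) => //.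
  - exact/sort_sorted/le_total.
  - by rewrite inE size_incr ltnS (leq_trans ij).
  - by rewrite inE size_incr.
pose d i := (incr x)`_i - (incr y)`_i.
have d_ge0 j : (j <= m.+1)%N -> 0 <= \sum_(i < j) d i.
  case: j => [|j] jm; first by rewrite big_ord0.
  by rewrite sumrB subr_ge0; exact: maj.
rewrite (sum_incr x) (sum_incr y) -subr_ge0 -sumrB.
apply: (@le_trans _ _ (\sum_(i < m.+1) s (incr x)`_i * d i)); last first.
  apply: ler_sum => i _; have im := ltn_ord i; rewrite ltnS in im.
  have := f_tangent _ _ (D_incr _ _ Dx im) (D_incr _ _ Dy im).
  by rewrite /d; lra.
apply: le_trans (ge_abel_sum (s := fun i => s (incr x)`_i) _ _).
- by apply: mulr_ge0; [apply: s_ge0; exact: D_incr|exact: d_ge0].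
- move=> i j /andP[ij jm].
  apply: s_anti; last by rewrite incr_le ?ij.
    by apply: D_incr => //; exact: leq_trans jm.
  exact: D_incr.
- by move=> j jm; apply: d_ge0; rewrite ltnW// ltnS.
Qed.

(** * Concavity of the logarithm of the distribution function in alpha *)

(** By the mean value theorem, f b - f a is (b - a) times a slope at a point
    between a and b.  That slope is at most s a if a < b, and at least s a if
    b < a, so both cases give the same inequality. *)
Lemma tangent_le_of_anti_derive (R : realType) (a b : R) (f s : R -> R) :
  (forall x : R, 0 < x -> is_derive x 1 f (s x)) ->
  (forall x y : R, 0 < x -> x <= y -> s y <= s x) ->
  0 < a -> 0 < b -> f b - f a <= s a * (b - a).
Proof.
move=> df s_anti a0 b0.
have f_cont (x y : R) : 0 < x -> {within `[x, y], continuous f}.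
  move=> x0; apply: derivable_within_continuous => t.
  rewrite in_itv/= => /andP[xt _].
  by have [] := df t (lt_le_trans x0 xt).
have df_itv (x y t : R) : 0 < x -> t \in `]x, y[%R -> is_derive t 1 f (s t).
  by move=> x0; rewrite in_itv/= => /andP[xt _]; apply: df; exact: lt_trans xt.
case: (ltgtP a b) => [ab|ba|->]; last by rewrite !subrr mulr0.
- have [c] := MVT ab (fun t => @df_itv a b t a0) (f_cont a b a0).
  rewrite in_itv/= => /andP[ac _] ->.
  by rewrite ler_wpM2r ?subr_ge0 ?(ltW ab)// s_anti// ltW.
- have [c] := MVT ba (fun t => @df_itv b a t b0) (f_cont b a b0).
  rewrite in_itv/= => /andP[bc ca] fab.
  rewrite -[leLHS]opprB fab -[b - a]opprB mulrN lerN2.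
  by rewrite ler_wpM2r ?subr_ge0 ?(ltW ba)// s_anti ?(ltW ca)// (lt_trans b0).
Qed.

(** Put b = 1 + lambda x and c = ln b, where x > 0.  The logarithm of
    [ENH_cdf] at x is beta times this function of a = alpha; the power b^a is
    written as exp (c a), which is simpler to differentiate in a. *)
Definition lnENH (R : realType) (c a : R) : R :=
  ln (1 - expR (1 - expR (c * a))).

Definition lnENH_slope (R : realType) (c a : R) : R :=
  c * (expR (c * a) / (expR (expR (c * a) - 1) - 1)).

Lemma lnENH_arg_gt0 (R : realType) (c a : R) : 0 < c -> 0 < a ->
  0 < 1 - expR (1 - expR (c * a)).
Proof.
by move=> c0 a0; rewrite subr_gt0 expR_lt1 subr_lt0 expR_gt1 mulr_gt0.
Qed.

Lemma is_derive_lnENH (R : realType) (c a : R) : 0 < c -> 0 < a ->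
  is_derive a 1 (lnENH c) (lnENH_slope c a).
Proof.
move=> c0 a0; have arg0 := lnENH_arg_gt0 c0 a0.
have dlin : is_derive a 1 (fun t : R => c * t) c.
  by apply: is_derive_eq; rewrite /GRing.scale /= mulr1.
have de1 := is_derive1_comp (g := fun t => c * t) (is_derive_expR (c * a)) dlin.
have de2 : is_derive a 1 (fun t => 1 - expR (c * t)) (- (expR (c * a) * c)).
  by apply: is_derive_eq; rewrite add0r mul1r.
have de3 := is_derive1_comp (g := fun t => 1 - expR (c * t))
  (is_derive_expR (1 - expR (c * a))) de2.
have de4 : is_derive a 1 (fun t => 1 - expR (1 - expR (c * t)))
    (expR (1 - expR (c * a)) * (expR (c * a) * c)).
  by apply: is_derive_eq; rewrite add0r mul1r mulrN opprK.
apply: (is_derive_eq (is_derive1_comp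
  (g := fun t => 1 - expR (1 - expR (c * t))) (is_derive1_ln arg0) de4)).
(* Only exp (u - 1), with u = exp (c a), may occur: the field tactic would
   treat exp (1 - u) as unrelated to it. *)
rewrite /lnENH_slope -[1 - expR (c * a)]opprB expRN.
rewrite -[1 - expR (c * a)]opprB expRN in arg0.
have E1 : 1 < expR (expR (c * a) - 1).
  by rewrite expR_gt1 subr_gt0 expR_gt1 mulr_gt0.
field.
by apply/andP; split; rewrite gt_eqF ?expR_gt0 ?subr_gt0.
Qed.

(** After clearing denominators, with p = exp (u - 1) and q = exp (v - u), the
    claim is v (p - 1) <= u (p q - 1).  The bound q >= 1 + (v - u) suffices:
    the difference of the two sides is then at least
    p (v - u) (u - 1) + (v - u). *)
Lemma ler_div_expRB1 (R : realType) (u v : R) : 1 < u -> u <= v ->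
  v / (expR (v - 1) - 1) <= u / (expR (u - 1) - 1).
Proof.
move=> u1 uv; have v1 := lt_le_trans u1 uv.
have E t : 1 < t -> 0 < expR (t - 1) - 1 :> R.
  by move=> t1; rewrite subr_gt0 expR_gt1 subr_gt0.
rewrite ler_pdivrMr ?E// mulrAC ler_pdivlMr ?E//.
have -> : expR (v - 1) = expR (u - 1) * expR (v - u).
  by rewrite -expRD; congr expR; lra.
have p0 := expR_ge0 (u - 1); have := expR_ge1Dx (v - u).
set p := expR (u - 1) in p0 *; set q := expR (v - u) => hq.
have h1 : 0 <= u * p * (q - (1 + (v - u))).
  by rewrite mulr_ge0 ?subr_ge0// mulr_ge0//; lra.
have h2 : 0 <= p * ((v - u) * (u - 1)).
  by rewrite mulr_ge0// mulr_ge0//; lra.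
by lra.
Qed.

Lemma lnENH_slope_ge0 (R : realType) (c a : R) : 0 < c -> 0 < a ->
  0 <= lnENH_slope c a.
Proof.
move=> c0 a0; rewrite /lnENH_slope mulr_ge0 ?(ltW c0)// divr_ge0 ?expR_ge0//.
by rewrite ltW// subr_gt0 expR_gt1 subr_gt0 expR_gt1 mulr_gt0.
Qed.

Lemma lnENH_slope_anti (R : realType) (c a b : R) : 0 < c -> 0 < a -> a <= b ->
  lnENH_slope c b <= lnENH_slope c a.
Proof.
move=> c0 a0 ab; rewrite /lnENH_slope (ler_pM2l c0) ler_div_expRB1//.
  by rewrite expR_gt1 mulr_gt0.
by rewrite ler_expR ler_pM2l.
Qed.

(** * The distribution of the maximum *)

Lemma cdf_max_rv (R : realType) (d : measure_display) (T : measurableType d)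
    (P : probability T R) (n : nat) (X : 'I_n.+1 -> {RV P >-> R}) (r : R) :
  mutually_independent X ->
  cdf (max_rv X) r = (\prod_(i < n.+1) cdf (X i) r)%E.
Proof.
move=> /(_ [set: 'I_n.+1]%SET (fun=> `]-oo, r]%classic)) indep.
transitivity (\prod_(i in [set: 'I_n.+1]%SET) cdf (X i) r)%E; last first.
  by apply: eq_bigl => i; rewrite inE.
rewrite -indep//; congr (P _); apply/seteqP; split => w /=.
- rewrite in_itv/= => /bigmax_leP[_ Xr] i _ /=.
  by rewrite in_itv/= Xr.
- move=> Xr; have Xir i : X i w <= r.
    by have := Xr i; rewrite /= inE in_itv/= => /(_ isT).
  by rewrite in_itv/=; apply/bigmax_leP; split=> // i _.
Qed.

Lemma ENH_cdf_lnENH (R : realType) (alpha lambda beta x : R) :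
  0 < alpha -> 0 < lambda -> 0 < x ->
  ENH_cdf alpha lambda beta x =
    expR (beta * lnENH (ln (1 + lambda * x)) alpha).
Proof.
move=> alpha0 lambda0 x0; have b1 : 1 < 1 + lambda * x.
  by rewrite ltrDl mulr_gt0.
have b_pow : (1 + lambda * x) `^ alpha = expR (ln (1 + lambda * x) * alpha).
  by rewrite /powR gt_eqF ?(lt_trans ltr01 b1)// mulrC.
have arg0 := lnENH_arg_gt0 (ln_gt0 b1) alpha0.
by rewrite /ENH_cdf x0 b_pow /powR (gt_eqF arg0).
Qed.

Lemma cdf_max_ENH (R : realType) (d : measure_display) (T : measurableType d)
    (P : probability T R) (n : nat) (X : 'I_n.+1 -> {RV P >-> R})
    (alpha : 'I_n.+1 -> R) (lambda beta x : R) :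
  mutually_independent X -> (forall i, ENH (alpha i) lambda beta (X i)) ->
  cdf (max_rv X) x = (\prod_(i < n.+1) ENH_cdf (alpha i) lambda beta x)%:E.
Proof.
move=> indepX X_ENH; rewrite cdf_max_rv// -prodEFin.
by apply: eq_bigr => i _; exact: X_ENH.
Qed.

Lemma prod_ENH_cdf (R : realType) (n : nat) (alpha : 'I_n -> R)
    (lambda beta x : R) :
  (forall i, 0 < alpha i) -> 0 < lambda -> 0 < x ->
  \prod_(i < n) ENH_cdf (alpha i) lambda beta x =
    expR (beta * \sum_(i < n) lnENH (ln (1 + lambda * x)) (alpha i)).
Proof.
move=> alpha0 lambda0 x0; rewrite mulr_sumr expR_sum.
by apply: eq_bigr => i _; exact: ENH_cdf_lnENH.
Qed.

Theorem theorem3p2 (R : realType) (n : nat) (lambda beta : R)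
    (alpha alpha' : 'I_n.+1 -> R)
    (d d' : measure_display) (T : measurableType d) (T' : measurableType d')
    (P : probability T R) (P' : probability T' R)
    (X : 'I_n.+1 -> {RV P >-> R}) (X' : 'I_n.+1 -> {RV P' >-> R})
    (lambda_gt0 : 0 < lambda) (beta_gt0 : 0 < beta)
    (alpha_gt0 : forall i, 0 < alpha i) (alpha'_gt0 : forall i, 0 < alpha' i)
    (indepX : mutually_independent X) (indepX' : mutually_independent X')
    (X_ENH : forall i, ENH (alpha i) lambda beta (X i))
    (X'_ENH : forall i, ENH (alpha' i) lambda beta (X' i))
    (alpha_maj : wsupmaj alpha alpha') :
  st_le (max_rv X') (max_rv X).
Proof.
move=> x; rewrite !ccdf_1_cdf leeB// (cdf_max_ENH x indepX X_ENH).
rewrite (cdf_max_ENH x indepX' X'_ENH) lee_fin.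
have [x0|x0] := ltP 0 x; last first.
  by apply: ler_prod => i _; rewrite /ENH_cdf ltNge x0 /= lexx.
rewrite [leLHS](prod_ENH_cdf _ alpha_gt0 lambda_gt0 x0).
rewrite [leRHS](prod_ENH_cdf _ alpha'_gt0 lambda_gt0 x0).
rewrite ler_expR (ler_pM2l beta_gt0).
set c := ln _; have c0 : 0 < c by rewrite ln_gt0// ltrDl mulr_gt0.
apply: (@wsupmaj_sum_le _ _ [set a | 0 < a] _ (lnENH_slope c)) => //=.
- by move=> a; exact: lnENH_slope_ge0.
- by move=> a b a0 _; exact: lnENH_slope_anti.
- move=> a b a0 b0; apply: tangent_le_of_anti_derive => // t.
  + exact: is_derive_lnENH.
  + by move=> u; exact: lnENH_slope_anti.
Qed.
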